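(* Let $(X,T,d)$ be a topological dynamical system. For $0<\rho<r$ define $$S_{\mathbb Z}(X,r,\rho)=\sup_{x\in X}\limsup_{M\to\infty}\frac1M\log N_{d_M}(B_{d_{\mathbb Z}}(x,r),\rho).$$ Then $$\mathrm{mdim}_{\mathrm A}(X,T,d)=\inf\left\{s>0:\ \exists C>0\ \ \forall\, 0<\rho<r,\ \ e^{S_{\mathbb Z}(X,r,\rho)}\le C(r/\rho)^s\right\}.$$
   Context: A topological dynamical system $(X,T,d)$ is a compact metric space $(X,d)$ with a homeomorphism $T:X\to X$. For $M\in\mathbb N=\{1,2,\dots\}$ put $d_M(x,y)=\max_{0\le m<M}d(T^mx,T^my)$ and $B_{d_M}(x,r)=\{y\in X: d_M(x,y)\le r\}$. Put also $B_{d_{\mathbb Z}}(x,r)=\{y\in X: d(T^Mx,T^My)\le r\text{ for all }M\in\mathbb Z\}$. For a metric $d$, a subset $K$ and $\varepsilon>0$, $N_d(K,\varepsilon)$ is the minimal $n\ge1$ such that $K$ can be covered by $n$ open sets of $d$-diameter at most $\varepsilon$. For $0<\rho<r$ let $$S(X,r,\rho)=\lim_{M\to\infty}\frac1M\sup_{x\in X}\log N_{d_M}(B_{d_M}(x,r),\rho)$$ (the limit exists by sub-additivity). The mean Assouad dimension is $$\mathrm{mdim}_{\mathrm A}(X,T,d)=\inf\{s>0:\exists C>0\ \forall\, 0<\rho<r,\ e^{S(X,r,\rho)}\le C(r/\rho)^s\}$$ (with $\inf\emptyset=+\infty$). *)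

(* Defs.v *)
From HB Require Import structures.
From mathcomp Require Import all_boot all_order all_algebra.
From mathcomp Require Import all_classical all_reals all_analysis.

Set Implicit Arguments.
Unset Strict Implicit.
Unset Printing Implicit Defensive.

Import Order.TTheory GRing.Theory Num.Theory.
Local Open Scope classical_set_scope.
Local Open Scope ring_scope.

Record homeomorphism (X : topologicalType) := Homeomorphism {
  homeo_fun :> X -> X ;
  homeo_inv : X -> X ;
  homeo_funK : cancel homeo_fun homeo_inv ;
  homeo_invK : cancel homeo_inv homeo_fun ;
  homeo_cts : continuous homeo_fun ;
  homeo_inv_cts : continuous homeo_inv }.

(* [Negz n] is the integer -(n+1). *)
Definition iterz (X : topologicalType) (T : homeomorphism X) (m : int) : X -> X :=
  match m with
  | Posz n => iter n T
  | Negz n => iter n.+1 (homeo_inv T)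
  end.

Section MeanAssouadDimension.
Context {R : realType} {X : metricType R}.
Implicit Types (T : homeomorphism X) (M : nat) (x y : X) (K U : set X).
Implicit Types (d : X -> X -> R) (r rho eps : R).

(* The base point 0 of the maximum only matters for M = 0, distances being
   nonnegative. *)
Definition dist_iter T M x y : R :=
  \big[Num.max/0]_(m < M) mdist (iter m T x) (iter m T y).

Definition ball_iter T M x r : set X := [set y | dist_iter T M x y <= r].

Definition ball_orbit T x r : set X :=
  [set y | forall m : int, mdist (iterz T m x) (iterz T m y) <= r].

(* The diameter of the empty set is -oo. *)
Definition diam d U : \bar R := ereal_sup [set (d x y)%:E | x in U & y in U].

(* Openness refers to the topology of [X]; the metrics [dist_iter T M], M >= 1,
   all induce that topology. *)
Definition open_coverable d K eps (n : nat) : Prop :=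
  exists U : 'I_n -> set X,
    (forall i, open (U i) /\ (diam d (U i) <= eps%:E)%E) /\
    K `<=` \bigcup_i U i.

(* The infimum of a nonempty set of natural numbers is its minimum; the value
   is +oo when there is no finite cover. *)
Definition cov_num d K eps : \bar R :=
  ereal_inf [set n%:R%:E | n in [set n | (1 <= n)%N /\ open_coverable d K eps n]].

(* In the two sequences below the term of index 0 is 0 and does not affect
   the limits. *)
Definition S_loc T r rho : \bar R :=
  limn (fun M => M%:R^-1%:E *
    ereal_sup [set lne (cov_num (dist_iter T M) (ball_iter T M x r) rho)
              | x in [set: X]])%E.

Definition S_Z T r rho : \bar R :=
  ereal_sup [set limn_esup (fun M =>
      (M%:R^-1%:E * lne (cov_num (dist_iter T M) (ball_orbit T x r) rho))%E)
    | x in [set: X]].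

Definition mdimA T : \bar R :=
  ereal_inf [set s%:E | s in [set s : R | 0 < s /\
    exists C : R, 0 < C /\
      forall r rho : R, 0 < rho -> rho < r ->
        (expeR (S_loc T r rho) <= (C * (r / rho) `^ s)%:E)%E]].

End MeanAssouadDimension.

(* Main.v *)
Require Import Defs.
From mathcomp Require Import all_boot all_order all_algebra.
From mathcomp Require Import all_classical all_reals all_analysis.
From mathcomp Require Import zify lra.

(** The two growth rates agree for every single pair of scales: for [0 < rho],
    [S_loc T r rho = S_Z T r rho], so the two infima range over the same
    exponents.

    One inequality is monotonicity, as the orbit ball [B_{d_Z}(x,r)] lies in
    every Bowen ball [B_{d_M}(x,r)]. The other follows the method of Bowen for
    entropy-expansive maps. Let [c > S_Z T r rho]. Each point
    [y] has a time [m >= 1] and a family of at most [exp (c m)] open sets of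
    [d_m]-diameter at most [rho] covering its orbit ball. The union of the
    family is an open neighbourhood of the orbit ball, and the orbit ball is
    the decreasing intersection of the sets of points staying [r]-close to [y]
    at the times in [(-N,N)]; by compactness such a set, for some finite [N]
    and for all centres near [y], is already inside the union. A second use of
    compactness makes [N] and the bound on [m] uniform
    ([uniform_step_covers_of_ball_orbit]). Now follow an orbit up to time [M]:
    away from the two ends, the points of [B_{d_M}(x,r)] stay [r]-close to [x]
    at [N] times on both sides of the present, so a block of [m <= N] steps
    costs a factor [exp (c m)]. Chaining the blocks and paying a constant for
    the ends covers [B_{d_M}(x,r)] by at most [exp (c M + C)] open sets, with
    [C] independent of [x] and [M] ([ball_iter_cover_growth]).

    The same chaining gives the existence of the limit in [S_loc]: if at one
    time [L] all Bowen balls have covers of at most [exp (c L)] sets, blocks of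
    constant length [L] show that the upper growth rate is at most [c]. Hence
    the upper limit is at most the lower one; this is Fekete's lemma here. *)

Set Implicit Arguments.
Unset Strict Implicit.
Unset Printing Implicit Defensive.

Import Order.TTheory GRing.Theory Num.Theory.
Import metricType_numDomainType.
Local Open Scope classical_set_scope.
Local Open Scope ring_scope.

(** * Upper and lower limits of extended real sequences *)

Section UpperLowerLimits.
Context {R : realType}.
Implicit Types (u v : nat -> \bar R) (b : \bar R).

(** Rates are compared below through finite thresholds [c]; the index has to
    be positive because the sequences of interest are normalised by [1 / N]. *)
Lemma limn_esup_lt u b :
  (limn_esup u < b)%E -> exists2 N, (0 < N)%N & (u N < b)%E.
Proof.
move=> /ereal_inf_lt[_ [V [N _ NV] <-] Vb]; exists N.+1 => //.
apply: le_lt_trans Vb; apply: ereal_sup_ubound; exists N.+1 => //.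
by apply: NV => /=.
Qed.

Lemma limn_einf_lt u b :
  (limn_einf u < b)%E -> exists2 N, (0 < N)%N & (u N < b)%E.
Proof.
move=> ub; have : (einfs u 1%N < b)%E.
  apply: le_lt_trans ub; rewrite limn_einf_lim.
  have -> : limn (einfs u) = ereal_sup (range (einfs u)).
    by apply/cvg_lim => //; exact: cvg_einfs_sup.
  by apply: ereal_sup_ubound; exists 1%N.
by move=> /ereal_inf_lt[_ [N /= N1 <-] Nb]; exists N.
Qed.

Lemma limn_esup_le_affine u (c C : R) :
  (forall M, (0 < M)%N -> (u M <= (c + C / M%:R)%:E)%E) -> (limn_esup u <= c%:E)%E.
Proof.
move=> uc; apply/lee_addgt0Pr => e e0; rewrite -EFinD.
apply: ge_ereal_inf; exists (ereal_sup (u @` [set M | (0 < M)%N /\ C / e < M%:R])).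
  exists [set M | (0 < M)%N /\ C / e < M%:R] => //.
  by apply: filterI; [exact: nbhs_infty_gt | exact: nbhs_infty_gtr].
apply/ereal_supP => _ [M [M0 CeM] <-]; rewrite (le_trans (uc M M0))// lee_fin.
rewrite lerD2l ler_pdivrMr ?ltr0n//; move: CeM; rewrite ltr_pdivrMr// => /ltW.
by rewrite mulrC.
Qed.

Lemma le_limn_esup u v : (forall M, (u M <= v M)%E) -> (limn_esup u <= limn_esup v)%E.
Proof.
move=> uv; apply/ereal_infP => _ [V FV <-]; apply: ge_ereal_inf.
exists (ereal_sup (u @` V)); first by exists V.
apply/ereal_supP => _ [M VM <-]; apply: le_trans (uv M) _.
by apply: ereal_sup_ubound; exists M.
Qed.

Lemma lim_of_limn_esup_le_einf u : (limn_esup u <= limn_einf u)%E -> limn u = limn_esup u.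
Proof.
move=> ule; have uE : limn_einf u = limn_esup u.
  by apply/eqP; rewrite eq_le limn_einf_sup ule.
apply/cvg_lim => //; apply: (@squeeze_cvge _ _ _ _ (einfs u) _ (esups u)).
- apply: nearW => M; apply/andP; split.
    by apply: ereal_inf_lbound; exists M => /=.
  by apply: ereal_sup_ubound; exists M => /=.
- by rewrite -uE limn_einf_lim; exact: is_cvg_einfs.
- by rewrite limn_esup_lim; exact: is_cvg_esups.
Qed.

Lemma lee_of_gt (x y : \bar R) : (forall c : R, (y < c%:E)%E -> (x <= c%:E)%E) -> (x <= y)%E.
Proof.
case: y => [y| |] H; last 2 first.
- exact: leey.
- case: x H => [x| |] H //; last by have := H 0 (ltNyr _).
  have : (x%:E <= (x - 1)%:E)%E by apply: H; exact: ltNyr.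
  by rewrite lee_fin lerDl oppr_ge0 ler10.
by apply/lee_addgt0Pr => e e0; rewrite -EFinD; apply: H; rewrite lte_fin ltrDl.
Qed.

End UpperLowerLimits.

(** * Covers with small diameter over a window of times *)

Section WindowCovers.
Context {R : realType} {X : metricType R} (T : homeomorphism X) (rho : R).
Implicit Types (a m l M N : nat) (A B : set X) (c : R).

(** Letting the window of times slide over a fixed set [A], instead of moving
    [A] along the orbit, makes concatenation of windows a plain product of
    covers; the bound [c] is logarithmic so that it adds up. *)
Definition window_cover a m A c : Prop :=
  exists (I : finType) (U : I -> set X),
    [/\ (0 < #|I|)%N, #|I|%:R <= expR c, forall i, open (U i),
        forall i x y, U i x -> U i y -> forall j, (a <= j < a + m)%N ->
          mdist (iter j T x) (iter j T y) <= rho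
      & A `<=` \bigcup_i U i].

Lemma window_coverS a m A B c c' :
  A `<=` B -> c <= c' -> window_cover a m B c -> window_cover a m A c'.
Proof.
move=> AB cc' [I [U [I0 Ic Uo Urho BU]]]; exists I, U; split => //.
- by rewrite (le_trans Ic)// ler_expR.
- exact: subset_trans BU.
Qed.

Lemma window_cover_ge0 a m A c : window_cover a m A c -> 0 <= c.
Proof.
move=> [I [U [I0 Ic _ _ _]]]; rewrite -ler_expR expR0 (le_trans _ Ic)//.
by rewrite ler1n.
Qed.

Lemma window_cover0 a A : window_cover a 0 A 0.
Proof.
exists unit, (fun=> setT); split=> //; rewrite ?card_unit ?expR0//.
- by move=> _; exact: openT.
- by move=> _ x y _ _ j; lia.
- by move=> x _; exists tt.
Qed.

Lemma continuous_iter t : continuous (iter t T).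
Proof.
elim: t => [|t IH] x; first exact: cvg_id.
exact: (continuous_comp (IH x) (@homeo_cts _ T _)).
Qed.

(** Pulling back along [T^t] delays the window by [t]. *)
Lemma window_cover_preimage t a m A B c : window_cover a m B c ->
  A `<=` iter t T @^-1` B -> window_cover (t + a) m A c.
Proof.
move=> [I [U [I0 Ic Uo Urho BU]]] AB.
exists I, (fun i => iter t T @^-1` U i); split => //.
- by move=> i; apply: open_comp (Uo i) => x _; exact: continuous_iter.
- move=> i x y /= Ux Uy j jam.
  have -> : j = ((j - t) + t)%N by lia.
  by rewrite !iterD; apply: Urho Ux Uy _ _; lia.
- by move=> x /AB /BU.
Qed.

(** Pairwise intersections: sizes multiply, so their logarithms add. *)
Lemma window_cover_cat a m l A c c' :
  window_cover a m A c -> window_cover (a + m) l A c' ->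
  window_cover a (m + l) A (c + c').
Proof.
move=> [I [U [I0 Ic Uo Urho AU]]] [J [V [J0 Jc Vo Vrho AV]]].
exists (I * J)%type, (fun p => U p.1 `&` V p.2); split.
- by rewrite card_prod muln_gt0 I0.
- by rewrite card_prod natrM expRD ler_pM.
- by move=> p; exact: openI.
- move=> p x y [Ux Vx] [Uy Vy] j jaml; have [jam|jam] := ltnP j (a + m).
    by apply: Urho Ux Uy _ _; lia.
  by apply: Vrho Vx Vy _ _; lia.
- by move=> x Ax; have [i _ Uix] := AU x Ax; have [j _ Vjx] := AV x Ax; exists (i, j).
Qed.

Lemma window_cover_one_step : compact [set: X] -> 0 < rho ->
  exists c, window_cover 0 1 setT c.
Proof.
move=> cptX rho0.
have [s sX] : exists s : seq X, forall x, exists2 y, y \in s & (ball y (rho / 2))° x.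
  (* Near-covering along the filter of all large finite lists extracts a
     finite subcover without a base point, so [X] may be empty. *)
  pose F := filter_from setT (fun s0 : seq X => [set s : seq X | {subset s0 <= s}]).
  have FF : Filter F.
    apply: filter_from_filter; first by exists [::].
    move=> s t _ _; exists (s ++ t) => // u /= stu.
    by split=> x xs; apply: stu; rewrite mem_cat xs ?orbT.
  have /compact_near_coveringP /(_ _ F
    (fun s x => exists2 y, y \in s & (ball y (rho / 2))° x) FF) [] := cptX.
    move=> x _; exists ((ball x (rho / 2))°, [set s : seq X | {subset [:: x] <= s}]).
      by split; [apply: nbhs_interior; apply: nbhsx_ballx; rewrite divr_gt0 | exists [:: x]].
    move=> [x' s] /= [xx' xs]; exists x => //; apply: xs; exact: mem_head.
  by move=> s _ /(_ s (fun _ => id)) sX; exists s => x; exact: sX.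
(* The extra empty set keeps the family nonempty when [s] is empty. *)
pose U (i : option 'I_(size s)) :=
  if i is Some k then (ball (tnth (in_tuple s) k) (rho / 2))° else set0.
exists (ln #|{: option 'I_(size s)}|%:R), _, U; split => //.
- by rewrite card_option.
- by rewrite lnK// posrE ltr0n card_option.
- by case=> [k|]; [exact: open_interior | exact: open0].
- case=> [k|]// x y /interior_subset Ux /interior_subset Uy [|//] _ /=.
  apply: ltW; have := ball_splitr Ux Uy.
  by rewrite ballEmdist.
- move=> x _; have [y ys yx] := sX x.
  have ks : (index y s < size s)%N by rewrite index_mem.
  exists (Some (Ordinal ks)) => //=.
  by rewrite (tnth_nth y) /= nth_index.
Qed.

(** The crude rate [kappa], valid for all sets and windows, pays for the
    boundedly many times that the finer estimates miss. *)
Lemma window_cover_compact : compact [set: X] -> 0 < rho ->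
  exists2 kappa, 0 <= kappa & forall m a A, window_cover a m A (kappa * m%:R).
Proof.
move=> cptX rho0; have [kappa K1] := window_cover_one_step cptX rho0.
exists kappa; first exact: window_cover_ge0 K1.
elim=> [|m IH] a A; first by rewrite mulr0; exact: window_cover0.
rewrite -[m.+1]add1n natrD mulrDr mulr1; apply: window_cover_cat => //.
by rewrite -[a in window_cover a]addn0; apply: window_cover_preimage K1 _.
Qed.

(** * From covers of short blocks to exponential growth *)

(** Every orbit can advance by a block of bounded length at the rate [c]. Being
    [r]-close during the [2 N] times [0, ..., 2 N - 1] means being [r]-close on
    both sides of time [N], where the block starts: this expresses two-sided
    closeness with forward iterates alone. *)
Definition uniform_step_covers r c N : Prop :=
  forall x, exists2 m, (0 < m <= N)%N &
    window_cover N m (ball_iter T N.*2 x r) (c * m%:R).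

(** Chain blocks along the orbit of [x] from time [N] on; the first [N] times,
    whose past is too short, and the last [2 N] times, whose future is too
    short, are covered at the crude rate. Hence the constant [3 kappa N]. *)
Lemma ball_iter_cover_growth r c N : compact [set: X] -> 0 < rho ->
  uniform_step_covers r c N ->
  exists C, forall M x, window_cover 0 M (ball_iter T M x r) (c * M%:R + C).
Proof.
move=> cptX rho0.
have [kappa kappa0 K] := window_cover_compact cptX rho0.
move=> H; exists (3 * (kappa * N%:R)) => M x.
have c0 : 0 <= c.
  have [m /andP[m0 _] /window_cover_ge0] := H x.
  by rewrite pmulr_lge0 // ltr0n.
have N0 : 0 <= kappa * N%:R by rewrite mulr_ge0.
have tail l a : (N <= a)%N -> (a + l = M)%N ->
    window_cover a l (ball_iter T M x r) (c * l%:R + 2 * (kappa * N%:R)).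
  elim/ltn_ind: l a => l IH a Na alM.
  have [lN|Nl] := leqP l (N.*2).
    apply: (window_coverS (fun _ => id) _ (K l a _)).
    have : kappa * l%:R <= kappa * (N.*2)%:R by rewrite ler_wpM2l // ler_nat.
    rewrite -muln2 natrM; have : 0 <= c * l%:R by rewrite mulr_ge0.
    lra.
  have [m /andP[m0 mN] Hm] := H (iter (a - N) T x).
  have ml : (m <= l)%N by lia.
  rewrite -(subnKC ml) natrD mulrDr -addrA.
  apply: window_cover_cat; last by apply: IH; lia.
  have -> : a = ((a - N) + N)%N by lia.
  apply: window_cover_preimage Hm _ => y.
  rewrite /ball_iter /= /dist_iter => /bigmax_leP[r0 yx]; apply/bigmax_leP.
  split=> // i _; rewrite -!iterD.
  have iM : (i + (a - N) < M)%N by have := ltn_ord i; lia.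
  exact: yx (Ordinal iM) isT.
have [MN|NM] := leqP M N.
  apply: (window_coverS (fun _ => id) _ (K M 0%N _)).
  have : kappa * M%:R <= kappa * N%:R by rewrite ler_wpM2l // ler_nat.
  have : 0 <= c * M%:R by rewrite mulr_ge0.
  lra.
have /(window_cover_cat (K N 0%N _)) := tail (M - N)%N (0 + N)%N (leqnn _) (subnKC (ltnW NM)).
rewrite subnKC ?(ltnW NM)//; apply: window_coverS => //.
have : c * (M - N)%:R <= c * M%:R by rewrite ler_wpM2l // ler_nat leq_subr.
lra.
Qed.

(** Covers of the orbit balls use a different block length at each point and
    constraints at infinitely many times; compactness turns them into covers
    with bounded block lengths and constraints at boundedly many times. *)
Lemma uniform_step_covers_of_ball_orbit r c : compact [set: X] ->
  (forall y, exists2 m, (0 < m)%N & window_cover 0 m (ball_orbit T y r) (c * m%:R)) ->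
  exists N, uniform_step_covers r c N.
Proof.
move=> /compact_near_coveringP cptX H.
pose W N u := [set w | forall j : int, (absz j < N)%N ->
  mdist (iterz T j u) (iterz T j w) <= r].
have iterzcts (j : int) : continuous (iterz T j).
  case: j => n; first exact: continuous_iter.
  rewrite /iterz; elim: n.+1 => [|k IH] x; first exact: cvg_id.
  exact: (continuous_comp (IH x) (@homeo_inv_cts _ T _)).
(* Outside [O] each [w] violates some constraint [j] of the orbit ball strictly;
   the violation persists for nearby [u] and [w'], and compactness in [w]
   leaves finitely many [j]. *)
have near_orbit y O : open O -> ball_orbit T y r `<=` O ->
    \forall u \near y & N \near \oo, W N u `<=` O.
  move=> Oo yO.
  pose F := filter_prod (nbhs y) (@nbhs nat _ \oo).
  have FF : Filter F by exact: filter_prod_filter.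
  suff : \forall p \near F, [set: X] `<=` [set w | W p.2 p.1 w -> O w].
    by apply: filterS => p pWO w /=; exact: pWO.
  apply: (cptX _ F (fun p w => W p.2 p.1 w -> O w) FF) => w _.
  have [Ow|nOw] := pselect (O w).
    exists (O, setT) => /=; first by split; [exact: open_nbhs_nbhs | exact: filterT].
    by move=> [w' p] [].
  have [j jyw] : exists j : int, r < mdist (iterz T j y) (iterz T j w).
    apply: contra_notP nOw => /forallNP yw; apply: yO => j.
    by have := yw j => /negP; rewrite -leNgt.
  pose e := (mdist (iterz T j y) (iterz T j w) - r) / 2.
  have e0 : 0 < e by rewrite divr_gt0// subr_gt0.
  have near_iterz z : nbhs z [set z' | mdist (iterz T j z) (iterz T j z') < e].
    exact: (cvgr_dist_lt (iterzcts j z)).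
  exists ([set w' | mdist (iterz T j w) (iterz T j w') < e],
          [set p | mdist (iterz T j y) (iterz T j p.1) < e /\ (absz j < p.2)%N]) => /=.
    split; first exact: near_iterz.
    exists ([set u | mdist (iterz T j y) (iterz T j u) < e],
            [set N | (absz j < N)%N]); last by move=> [].
    by split; [exact: near_iterz | exact: nbhs_infty_gt].
  move=> [w' [u N]] /= [ww' [yu jN]] /(_ j jN) uw'.
  have := metric_triangle (iterz T j y) (iterz T j u) (iterz T j w).
  have := metric_triangle (iterz T j u) (iterz T j w') (iterz T j w).
  rewrite [mdist (iterz T j w') _]metric_sym; move: ww' yu; rewrite /e; lra.
pose P N u := exists2 m, (0 < m <= N)%N & window_cover 0 m (W N u) (c * m%:R).
have [N _ /(_ N (leqnn _)) NP] : \forall N \near \oo, [set: X] `<=` P N.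
  apply: (cptX _ _ P _) => y _.
  have [m m0 [I [U [I0 Ic Uo Urho AU]]]] := H y.
  have := near_orbit y _ (bigcup_open (fun i _ => Uo i)) AU.
  move=> [[V Q] [/= Vy [N0 _ QN0]] VQ].
  exists (V, [set N | (N0 <= N)%N /\ (m <= N)%N]) => /=.
    split=> //; exists (maxn N0 m) => // N /=; rewrite geq_max => /andP[]; by split.
  move=> [u N] [/= Vu [N0N mN]]; exists m; first by rewrite m0.
  exists I, U; split=> // w; apply: (VQ (u, N)); split => //; exact: QN0.
exists N => x; have [m mN Wm] := NP (iter N T x) I.
exists m => //; rewrite -[N in window_cover N]addn0.
apply: window_cover_preimage Wm _ => y /bigmax_leP[r0 xy] j jN /=.
(* The times [j] with [|j| < N] seen from [T^N x] are the times [N + j] of [x]. *)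
have iterz_iter z : iterz T j (iter N T z) = iter (absz (N%:Z + j)%R) T z.
  case: j jN => n jN; first by rewrite -PoszD absz_nat addnC iterD.
  have {1}-> : N = (n.+1 + (N - n.+1))%N by lia.
  rewrite iterD /iterz; have -> k w : iter k (homeo_inv T) (iter k T w) = w.
    by elim: k w => // k IH w; rewrite iterS iterSr IH homeo_funK.
  by congr (iter _ T z); lia.
have jN2 : (absz (N%:Z + j)%R < N.*2)%N by lia.
by rewrite !iterz_iter; exact: xy (Ordinal jN2) isT.
Qed.

(** * Growth rates of covering numbers *)

Lemma diam_leP (d : X -> X -> R) (U : set X) (e : R) :
  (diam d U <= e%:E)%E <-> forall x y, U x -> U y -> d x y <= e.
Proof.
split=> [/ereal_supP H x y Ux Uy | H].
  by rewrite -lee_fin; apply: H; exists x => //; exists y.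
by apply/ereal_supP => _ [x Ux [y Uy <-]]; rewrite lee_fin; exact: H.
Qed.

Lemma cov_num_ge0 (d : X -> X -> R) A e : (0 <= cov_num d A e)%E.
Proof. by apply/ereal_infP => _ [n _ <-]; rewrite lee_fin. Qed.

(** The covering number is a minimum over naturals written as an infimum of
    extended reals: comparing with the integer part of [expR c] plus one shows
    that a bound on the infimum is met by an actual cover. *)
Lemma lne_cov_num_leP M A c : 0 <= rho ->
  (lne (cov_num (dist_iter T M) A rho) <= c%:E)%E <-> window_cover 0 M A c.
Proof.
move=> rho0.
have -> : (lne (cov_num (dist_iter T M) A rho) <= c%:E)%E =
          (cov_num (dist_iter T M) A rho <= (expR c)%:E)%E.
  by rewrite -[c%:E]expeRK lee_lne ?in_itv /= ?leey ?andbT ?lee_fin ?expR_ge0 ?cov_num_ge0.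
split.
  move=> Hc.
  have /ereal_inf_lt[_ [n [n1 [U [Urho AU]]] <-]] :
      (cov_num (dist_iter T M) A rho < (Num.trunc (expR c)).+1%:R%:E)%E.
    by rewrite (le_lt_trans Hc)// lte_fin truncnS_gt.
  rewrite lte_fin ltr_nat ltnS => nc.
  exists 'I_n, U; split => //.
  - by rewrite card_ord.
  - rewrite card_ord (@le_trans _ _ (Num.trunc (expR c))%:R)// ?ler_nat//.
    by rewrite truncn_le expR_ge0.
  - by move=> i; have [] := Urho i.
  - move=> i x y Ux Uy j jM; have [_ /diam_leP/(_ x y Ux Uy)/bigmax_leP[_ H]] := Urho i.
    exact: H (Ordinal jM) isT.
move=> [I [U [I0 Ic Uo Urho AU]]].
apply: (@le_trans _ _ #|I|%:R%:E); last by rewrite lee_fin.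
apply: ereal_inf_lbound; exists #|I| => //; split => //.
exists (fun k => U (enum_val k)); split.
  move=> k; split; first exact: Uo.
  apply/diam_leP => x y Ux Uy; apply/bigmax_leP; split => // j _.
  by apply: Urho Ux Uy _ _; rewrite add0n ltn_ord.
by move=> x /AU[i _ Uix]; exists (enum_rank i) => //=; rewrite enum_rankK.
Qed.

Lemma scaled_lne_cov_num_leP M A c : 0 <= rho -> (0 < M)%N ->
  (M%:R^-1%:E * lne (cov_num (dist_iter T M) A rho) <= c%:E)%E <->
  window_cover 0 M A (c * M%:R).
Proof.
move=> rho0 M0; rewrite lee_pdivrMl ?ltr0n// -EFinM mulrC.
exact: lne_cov_num_leP.
Qed.

(** Both nontrivial inequalities are instances of block chaining: variable
    blocks from orbit balls bound the upper limit by [S_Z], blocks of one fixed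
    length bound it by the lower limit. *)
Lemma S_loc_eq_S_Z r : compact [set: X] -> 0 < rho -> S_loc T r rho = S_Z T r rho.
Proof.
move=> cptX rho0.
pose u M := (M%:R^-1%:E * ereal_sup [set lne (cov_num (dist_iter T M)
  (ball_iter T M x r) rho) | x in [set: X]])%E.
have uP M c : (0 < M)%N -> (u M <= c%:E)%E <->
    forall x, window_cover 0 M (ball_iter T M x r) (c * M%:R).
  move=> M0; rewrite /u lee_pdivrMl ?ltr0n// -EFinM mulrC; split.
    move=> /ereal_supP H x; apply/lne_cov_num_leP; first exact: ltW.
    by apply: H; exists x.
  move=> H; apply/ereal_supP => _ [x _ <-].
  by apply/lne_cov_num_leP; [exact: ltW | exact: H].
have esup_le c N : uniform_step_covers r c N -> (limn_esup u <= c%:E)%E.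
  move=> /(ball_iter_cover_growth cptX rho0)[C HC].
  apply: (@limn_esup_le_affine _ u c C) => M M0; apply/uP => // x.
  by rewrite mulrDl divfK ?pnatr_eq0 -?lt0n.
have S_Z_le : (S_Z T r rho <= limn_esup u)%E.
  apply/ereal_supP => _ [x _ <-]; apply: le_limn_esup => M.
  apply: lee_wpmul2l; first by rewrite lee_fin.
  apply: le_ereal_sup_tmp.
  exists (lne (cov_num (dist_iter T M) (ball_iter T M x r) rho)); first by exists x.
  rewrite lee_lne ?in_itv /= ?leey ?andbT ?cov_num_ge0//.
  apply: ereal_inf_le_tmp => _ [n [n1 [U [Urho AU]]] <-]; exists n => //.
  split=> //; exists U; split=> //; apply: subset_trans AU => y xy.
  apply/bigmax_leP; split; first exact: le_trans (mdist_ge0 _ _) (xy 0).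
  by move=> k _; exact: (xy (Posz k)).
have le_S_Z : (limn_esup u <= S_Z T r rho)%E.
  apply: lee_of_gt => c Sc.
  have [|N HN] := uniform_step_covers_of_ball_orbit cptX (r := r) (c := c); last exact: esup_le HN.
  move=> y; have [|M M0 /ltW yc] := @limn_esup_lt _
      (fun M => M%:R^-1%:E * lne (cov_num (dist_iter T M) (ball_orbit T y r) rho))%E c%:E.
    by apply: le_lt_trans Sc; apply: ereal_sup_ubound; exists y.
  by exists M => //; apply/scaled_lne_cov_num_leP => //; exact: ltW.
have esup_einf : (limn_esup u <= limn_einf u)%E.
  apply: lee_of_gt => c /limn_einf_lt[N N0 /ltW /(uP _ _ N0) HN].
  (* The future half of the [2 N] constraints is a ball at [T^N x]. *)
  apply: (esup_le _ N) => x; exists N; first by rewrite N0 leqnn.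
  rewrite -[N in window_cover N]addn0.
  apply: window_cover_preimage (HN (iter N T x)) _ => y /bigmax_leP[r0 xy].
  apply/bigmax_leP; split => // i _; rewrite -!iterD.
  have iN : (i + N < N.*2)%N by have := ltn_ord i; lia.
  exact: xy (Ordinal iN) isT.
rewrite /S_loc -/u (lim_of_limn_esup_le_einf esup_einf).
by apply/eqP; rewrite eq_le le_S_Z.
Qed.

End WindowCovers.

Theorem proposition3p4 (R : realType) (X : metricType R)
    (cptX : compact [set: X]) (T : homeomorphism X) :
  mdimA T =
  ereal_inf [set s%:E | s in [set s : R | (0 < s)%R /\
    exists C : R, (0 < C)%R /\
      forall r rho : R, (0 < rho)%R -> (rho < r)%R ->
        (expeR (S_Z T r rho) <= (C * (r / rho) `^ s)%:E)%E]]%classic.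
Proof.
rewrite /mdimA; congr (ereal_inf [set s%:E | s in _]).
apply/seteqP; split=> s [s0 [C [C0 HC]]]; split=> //; exists C; split=> //;
  by move=> r rho rho0 rhor; move: (HC r rho rho0 rhor); rewrite S_loc_eq_S_Z.
Qed.
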